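(* Consider a piecewise-linear tax code with known, fixed supports, and $N$ taxpayers with observed inputs, tax-group memberships and status-quo liabilities $\mathbf{y}'=(y'_1,\dots,y'_N)\in\mathbb{R}^N$. Stack the recovery equality constraints (each taxpayer's liability under the code equals the observed liability) as $\mathbf{y}'=X\boldsymbol{\theta}$, where $\boldsymbol{\theta}\in\mathbb{R}^P$ collects the free parameters of the system (the bracket rates $\alpha_{j,b,k}$ and the lump sums $Z_k$) and each row of the design matrix $X\in\mathbb{R}^{N\times P}$ holds the corresponding bracketed inputs $g_b(x_{ij};\Phi_{j,k})$ and group indicators for one taxpayer. Suppose the observed liabilities are generated by the model with true parameters $\boldsymbol{\theta}^\star\in\mathbb{R}^P$, i.e. $\mathbf{y}'=X\boldsymbol{\theta}^\star$. Then: (i) if $X$ has full column rank, the recovery problem (find $\boldsymbol{\theta}\in\mathbb{R}^P$ with $X\boldsymbol{\theta}=\mathbf{y}'$) has a unique solution, equal to the true parameters $\boldsymbol{\theta}^\star$; (ii) if $X$ is column-rank-deficient, the feasible set of the recovery problem is the affine subspace $\{\boldsymbol{\theta}^\star+v : v\in\ker X\}$, and every parameterization in it reproduces the observed liabilities exactly.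
   Context: Bracketing function: for a finite ordered support $\Phi=\{\phi_0,\dots,\phi_B\}$ with $0=\phi_0<\phi_1<\cdots<\phi_B$ (with $\phi_B=\infty$ allowed), $g_b(x;\Phi)=\max\{0,\min(x,\phi_b)-\phi_{b-1}\}$ for $x\ge0$ and $b=1,\dots,B$. Tax code: taxpayers are partitioned into finitely many tax groups indexed by $k$; inputs are indexed by $j$, and $x_{ij}\ge 0$ is taxpayer $i$'s value of input $j$. For each input $j$ and group $k$ there is a known support $\Phi_{j,k}$ whose brackets are indexed by $\mathcal{B}_{j,k}$. The liability of taxpayer $i$ in group $k$ is $f_k(\mathbf{x}_i)=\sum_j\sum_{b\in\mathcal{B}_{j,k}}\alpha_{j,b,k}\,g_b(x_{ij};\Phi_{j,k})+Z_k$, with real rates $\alpha_{j,b,k}$ and lump sums $Z_k$. The vector $\boldsymbol{\theta}$ stacks all $\alpha_{j,b,k}$ and $Z_k$; for a taxpayer $i$ in group $k$, row $i$ of $X$ has entry $g_b(x_{ij};\Phi_{j,k})$ in the column of $\alpha_{j,b,k}$, entry $1$ in the column of $Z_k$, and $0$ in the columns of parameters of other groups, so that $(X\boldsymbol{\theta})_i=f_k(\mathbf{x}_i)$. Recovery problem: the linear feasibility problem of minimizing the constant $0$ over the parameters subject to $f_k(\mathbf{x}_i)=y'_i$ for all taxpayers $i$ (with $k$ the group of $i$). *)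

(* Defs.v *)
From HB Require Import structures.
From mathcomp Require Import all_boot all_order all_algebra.
From mathcomp Require Import boolp classical_sets reals constructive_ereal.
Set Implicit Arguments.
Unset Strict Implicit.
Unset Printing Implicit Defensive.
Import Order.TTheory GRing.Theory Num.Theory.
Local Open Scope classical_set_scope.
Local Open Scope ring_scope.

(* Breakpoints 0 = phi_0 < ... < phi_B in the extended reals.  Strict
   monotonicity leaves only phi_B possibly infinite.  The degenerate support
   {0}, with B = 0 and no bracket, is not excluded. *)
Record bracket_support (R : realType) := BracketSupport {
  nbrackets : nat;
  breakpoint :> 'I_nbrackets.+1 -> \bar R;
  breakpoint0 : breakpoint ord0 = 0%E;
  breakpoint_lt : forall a b : 'I_nbrackets.+1,
    (a < b)%N -> (breakpoint a < breakpoint b)%E }.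

(* Brackets are numbered from 0: b : 'I_B is the bracket from phi_b to
   phi_(b+1).  The extended real under [fine] is finite (bracketingE). *)
Definition bracketing (R : realType) (Phi : bracket_support R)
    (b : 'I_(nbrackets Phi)) (x : R) : R :=
  fine (Order.max 0%E
    (Order.min x%:E (Phi (lift ord0 b)) - Phi (widen_ord (leqnSn _) b))%E).

Lemma bracketingE (R : realType) (Phi : bracket_support R)
    (b : 'I_(nbrackets Phi)) (x : R) :
  (bracketing b x)%:E =
  Order.max 0%E
    (Order.min x%:E (Phi (lift ord0 b)) - Phi (widen_ord (leqnSn _) b))%E.
Proof.
have lt_lo_hi : (Phi (widen_ord (leqnSn _) b) < Phi (lift ord0 b))%E.
  by apply: breakpoint_lt.
have lo_ge0 : (0 <= Phi (widen_ord (leqnSn _) b))%E.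
  have [b0|b_gt0] := posnP b; last first.
    by rewrite -[X in (X <= _)%E](breakpoint0 Phi) ltW// breakpoint_lt.
  rewrite -[X in (X <= _)%E](breakpoint0 Phi).
  by rewrite (_ : widen_ord _ b = ord0)//; apply: val_inj.
rewrite /bracketing.
case: (Phi (widen_ord _ b)) lt_lo_hi lo_ge0 => [l| |] //; last first.
  by rewrite ltNge leey.
case: (Phi (lift ord0 b)) => [h| |] // _ _.
  by rewrite -EFin_min -EFinB -EFin_max.
by rewrite minElt ltry -EFinB -EFin_max.
Qed.

Section TaxCode.
Variables (R : realType) (J K : finType) (Phi : J -> K -> bracket_support R).

(* The free parameters: one rate per (j, k) and bracket of Phi j k, and one
   lump sum per group. *)
Definition param : finType :=
  ({jk : J * K & 'I_(nbrackets (Phi jk.1 jk.2))} + K)%type.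

Definition rate_index (j : J) (k : K) (b : 'I_(nbrackets (Phi j k))) : param :=
  inl (Tagged (fun jk : J * K => 'I_(nbrackets (Phi jk.1 jk.2)))
              (b : 'I_(nbrackets (Phi (j, k).1 (j, k).2)))).

Definition lump_index (k : K) : param := inr k.

Definition rate (theta : 'cV[R]_#|param|) (j : J) (k : K)
    (b : 'I_(nbrackets (Phi j k))) : R :=
  theta (enum_rank (rate_index b)) 0.

Definition lump_sum (theta : 'cV[R]_#|param|) (k : K) : R :=
  theta (enum_rank (lump_index k)) 0.

Definition liability (theta : 'cV[R]_#|param|) (k : K) (x : J -> R) : R :=
  \sum_(j : J) \sum_(b < nbrackets (Phi j k))
    rate theta b * bracketing b (x j)
  + lump_sum theta k.

Variables (N : nat) (group : 'I_N -> K) (x : 'I_N -> J -> R).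

Definition design : 'M[R]_(N, #|param|) :=
  \matrix_(i, p)
    match enum_val p with
    | inl (existT jk b) =>
        if jk.2 == group i then bracketing b (x i jk.1) else 0
    | inr k => if k == group i then 1 else 0
    end.

Lemma design_mulE (theta : 'cV[R]_#|param|) (i : 'I_N) :
  (design *m theta) i 0 = liability theta (group i) (x i).
Proof.
rewrite mxE (reindex enum_rank) /=; last first.
  by exists enum_val => p _; rewrite (enum_rankK, enum_valK).
rewrite big_sumType /=; congr (_ + _).
  under eq_bigr do rewrite mxE enum_rankK.
  pose F (jk : J * K) (b : 'I_(nbrackets (Phi jk.1 jk.2))) : R :=
    (if jk.2 == group i then bracketing b (x i jk.1) else 0) *
    theta (enum_rank (inl (Tagged
      (fun jk : J * K => 'I_(nbrackets (Phi jk.1 jk.2))) b) : param)) 0.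
  transitivity (\sum_(jk : J * K) \sum_b F (jk.1, jk.2) b).
    rewrite sig_big_dep /=; apply: eq_bigr => -[[j k] b] _; by [].
  rewrite -(pair_bigA _ (fun j k => \sum_b F (j, k) b)) /=.
  apply: eq_bigr => j _; rewrite (bigD1 (group i))//= [X in _ + X]big1 ?addr0.
    by apply: eq_bigr => b _; rewrite /F /= eqxx mulrC.
  by move=> k /negPf kg; apply: big1 => b _; rewrite /F /= kg mul0r.
rewrite (bigD1 (group i))//= big1 ?addr0.
  by rewrite mxE enum_rankK eqxx mul1r.
by move=> k /negPf kg; rewrite mxE enum_rankK kg mul0r.
Qed.

Variable y : 'cV[R]_N.

Definition recovery_feasible : set 'cV[R]_#|param| :=
  [set theta | forall i, liability theta (group i) (x i) = y i 0].

Definition recovery_objective (theta : 'cV[R]_#|param|) : R := 0.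

Definition recovery_solutions : set 'cV[R]_#|param| :=
  [set theta | recovery_feasible theta /\
    forall theta', recovery_feasible theta' ->
      recovery_objective theta <= recovery_objective theta'].

End TaxCode.

(* The kernel acting on column vectors; the library's kermx is the left
   kernel, for row vectors. *)
Definition kernel (R : realType) (m n : nat) (A : 'M[R]_(m, n)) :
    set 'cV[R]_n := [set v | A *m v = 0].

(* Main.v *)
Require Import Defs.
From HB Require Import structures.
From mathcomp Require Import all_boot all_order all_algebra.
From mathcomp Require Import boolp classical_sets reals constructive_ereal.
Import Order.TTheory GRing.Theory Num.Theory.
Local Open Scope classical_set_scope.
Local Open Scope ring_scope.

(** By [design_mulE] the recovery constraints are the linear system [X *m theta = y]. Since
    [theta_star] solves it, its solution set is the coset of the kernel of [X] through [theta_star]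
    ([preimage_mulmx_kernel]). Full column rank makes the kernel trivial ([kernel_full_col_rank]),
    so the coset shrinks to the single point [theta_star]. *)

Lemma recovery_feasibleE (R : realType) (J K : finType)
    (Phi : J -> K -> bracket_support R) (N : nat)
    (group : 'I_N -> K) (x : 'I_N -> J -> R) (y : 'cV[R]_N) :
  recovery_feasible group x y =
  [set theta | design Phi group x *m theta = y].
Proof.
apply/seteqP; split=> theta /=.
  by move=> feas; apply/matrixP => i j; rewrite ord1 design_mulE feas.
by move=> <- i; rewrite design_mulE.
Qed.

(** The objective is constant, so every feasible point is already a minimizer. *)
Lemma recovery_solutionsE (R : realType) (J K : finType)
    (Phi : J -> K -> bracket_support R) (N : nat)
    (group : 'I_N -> K) (x : 'I_N -> J -> R) (y : 'cV[R]_N) :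
  recovery_solutions (Phi := Phi) group x y = recovery_feasible group x y.
Proof.
by apply/seteqP; split=> [theta []//|theta feas]; split=> // theta' _; exact: lexx.
Qed.

(** Two vectors have the same image under [A] exactly when their difference lies in the kernel; the
    witness for [t] is [t - u]. *)
Lemma preimage_mulmx_kernel (R : realType) (m n : nat) (A : 'M[R]_(m, n))
    (u : 'cV[R]_n) :
  [set t | A *m t = A *m u] = [set u + v | v in kernel A].
Proof.
apply/seteqP; split=> [t /= At|_ /= [v Av <-]].
  by exists (t - u); rewrite /kernel /= ?mulmxBr ?At ?subrr// addrC subrK.
by rewrite mulmxDr Av addr0.
Qed.

(** Rank equal to the number of columns is what [row_full] means (the rows span the whole space);
    [A] then has a left inverse, so [A] cancels on the left in [A *m v = A *m 0]. *)
Lemma kernel_full_col_rank (R : realType) (m n : nat) (A : 'M[R]_(m, n)) :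
  \rank A = n -> kernel A = [set 0].
Proof.
move=> rkA; apply/seteqP; split=> [v /= Av|_ /= ->]; last exact: mulmx0.
by apply: (row_full_inj (A := A)); rewrite ?mulmx0// /row_full rkA.
Qed.

Theorem proposition2 (R : realType) (J K : finType)
    (Phi : J -> K -> bracket_support R) (N : nat)
    (group : 'I_N -> K) (x : 'I_N -> J -> R)
    (x_ge0 : forall i j, 0 <= x i j)
    (y : 'cV[R]_N) (theta_star : 'cV[R]_#|param Phi|)
    (y_model : y = design Phi group x *m theta_star) :
  (\rank (design Phi group x) = #|param Phi| ->
     recovery_solutions group x y = [set theta_star])
  /\
  ((\rank (design Phi group x) < #|param Phi|)%N ->
     recovery_feasible group x y =
       [set theta_star + v | v in kernel (design Phi group x)]
     /\
     (forall theta : 'cV[R]_#|param Phi|,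
        [set theta_star + v | v in kernel (design Phi group x)] theta ->
        forall i, liability theta (group i) (x i) = y i 0)).
Proof.
(* Both parts are read off from this coset description of the feasible set. *)
have feasE : recovery_feasible group x y =
    [set theta_star + v | v in kernel (design Phi group x)].
  by rewrite recovery_feasibleE y_model preimage_mulmx_kernel.
split=> [full_rank|_].
  rewrite recovery_solutionsE feasE kernel_full_col_rank// image_set1.
  by rewrite addr0.
by split=> // theta; rewrite -feasE.
Qed.
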